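(* For every LTL$_f$ formula $\varphi$, Algorithm 2 (described below) solves the synthesis under environment specifications problem with $\mathit{Task}=\forall\varphi$ and $\mathit{Env}=\mathit{true}$: if it outputs ''Unrealisable'' then no agent strategy enforces $\forall\varphi$, and otherwise its output is a finite-state agent strategy that enforces $\forall\varphi$. Algorithm 2: let $(\mathcal D,\mathrm{safe}(T_1))=\mathrm{ConvertDA}(\forall\varphi)$, with initial state $\iota$; compute $(S_1,f)=\mathrm{Solve}_{ag}(\mathcal D,\mathrm{safe}(T_1))$; if $\iota\notin S_1$ output ''Unrealisable''; otherwise output $\mathrm{Strategy}(\mathcal D,f)$.
   Context: Fix a finite set $\mathcal P$ of atomic propositions partitioned into disjoint sets $\mathcal X$ (environment-controlled) and $\mathcal Y$ (agent-controlled); $\Sigma=2^{\mathcal P}$. LTL$_f$ formulas: $\varphi ::= p \mid \neg\varphi\mid \varphi\wedge\varphi\mid \mathsf{X}\varphi\mid \varphi\,\mathsf{U}\,\varphi$, evaluated on finite nonempty traces with standard finite-trace semantics ($\mathsf X\varphi$ holds at $i$ iff $i<|\pi|-1$ and $\varphi$ holds at $i+1$; $\varphi_1\mathsf U\varphi_2$ holds at $i$ iff $\varphi_2$ holds at some $j$ with $i\le j<|\pi|$ and $\varphi_1$ holds at all $k$ with $i\le k<j$); $\pi\models\varphi$ means $\varphi$ holds at position 0. $\exists\varphi$ is the set of infinite traces with some finite nonempty prefix satisfying $\varphi$; $\forall\varphi$ is the set of infinite traces all of whose finite nonempty prefixes satisfy $\varphi$; $\mathit{true}=\Sigma^\omega$.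 Agent strategies are $\sigma_{ag}:(2^{\mathcal X})^*\to2^{\mathcal Y}$, environment strategies $\sigma_{env}:(2^{\mathcal Y})^+\to2^{\mathcal X}$; the agent moves first: $(Y_0\cup X_0)(Y_1\cup X_1)\cdots$ follows $\sigma_{ag}$ iff $Y_0=\sigma_{ag}(\epsilon)$, $Y_{i+1}=\sigma_{ag}(X_0\cdots X_i)$, and follows $\sigma_{env}$ iff $X_i=\sigma_{env}(Y_0\cdots Y_i)$. $\sigma_{ag}$ enforces $P\subseteq\Sigma^\omega$ iff every play against any environment strategy lies in $P$; $\sigma_{ag}$ enforces $\mathit{Task}$ under $\mathit{Env}$ iff every play against any environment strategy that enforces $\mathit{Env}$ lies in $\mathit{Task}$ (with $\mathit{Env}=\mathit{true}$ this is just enforcing $\mathit{Task}$). A strategy is finite-state if computed by a finite-state transducer. Building blocks: a transition system $\mathcal D=(\Sigma,Q,\iota,\delta)$ ($Q$ finite, $\delta:Q\times\Sigma\to Q$); $\mathcal D_q$ is $\mathcal D$ with initial state $q$. For an LTL$_f$ formula $\varphi$ let $\mathcal M_\varphi=(\Sigma,Q,\iota,\delta,F)$ be a DFA accepting exactly the finite nonempty traces satisfying $\varphi$. For $T\subseteq Q$, $\mathrm{reach}(T)$ is the set of infinite runs visiting $T$ at some index $k\ge0$, $\mathrm{safe}(T)$ the set of infinite runs in $T$ at every index. $\mathrm{ConvertDA}(\exists\varphi)=((\Sigma,Q,\iota,\delta),\mathrm{reach}(F))$ and $\mathrm{ConvertDA}(\forall\varphi)=((\Sigma,Q,\iota,\delta),\mathrm{safe}(F\cup\{\iota\}))$.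 Game on $(\mathcal D,\alpha)$: an agent strategy wins from $q$ if the run of $\mathcal D_q$ on every infinite trace following it lies in $\alpha$; an environment strategy wins from $q$ if the run of $\mathcal D_q$ on every trace following it lies in $\alpha$. For $p\in\{ag,env\}$, $\mathrm{Solve}_p(\mathcal D,\alpha)$ (with $\alpha$ a reachability or safety condition) returns the winning region of $p$ (the set of states from which $p$ has a winning strategy) and a positional function $f$ (for $p=ag$, $f:Q\to2^{\mathcal Y}$) whose induced strategy wins from every state of that region. For $f:Q\to2^{\mathcal Y}$, $\mathrm{Strategy}(\mathcal D,f)$ is the agent strategy with $\sigma(\epsilon)=f(\iota)$ and $\sigma(X_0\cdots X_k)=f(q_{k+1})$, where $q_0\cdots q_{k+1}$ is the run of $\mathcal D$ on $(Y_0\cup X_0)\cdots(Y_k\cup X_k)$ and $Y_0,\dots,Y_k$ are the agent's own previous moves under $\sigma$.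
   Formalization: The DFA for φ is additionally required never to re-enter its initial state ι after a nonempty word (always achievable with a fresh initial state); otherwise safe(F∪{ι}) can exceed ∀φ and the claim fails, e.g. for φ = true U x with ι looping on ¬x. *)

(* Defs.v *)
From mathcomp Require Import all_boot.

Set Implicit Arguments.
Unset Strict Implicit.
Unset Printing Implicit Defensive.

(* The atoms P, partitioned into X (environment) and Y (agent), are the sum
   type X + Y, so that Sigma = 2^P is {set X + Y}. *)
Notation letter X Y := {set X + Y}.
Notation trace X Y := (nat -> letter X Y).
Notation lang X Y := (trace X Y -> Prop).

Definition env_part (X Y : finType) (a : letter X Y) : {set X} :=
  [set x | inl x \in a].

Definition ag_part (X Y : finType) (a : letter X Y) : {set Y} :=
  [set y | inr y \in a].

(* The letter Y_i \cup X_i. *)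
Definition join (X Y : finType) (Yi : {set Y}) (Xi : {set X}) : letter X Y :=
  (@inr X Y @: Yi) :|: (@inl X Y @: Xi).

Inductive ltlf (P : Type) : Type :=
| Atom of P
| Neg of ltlf P
| And of ltlf P & ltlf P
| Next of ltlf P
| Until of ltlf P & ltlf P.

(* Meaningful for i < size pi. *)
Fixpoint holds (P : finType) (pi : seq {set P}) (i : nat) (phi : ltlf P) : Prop :=
  match phi with
  | Atom p => p \in nth set0 pi i
  | Neg f => ~ holds pi i f
  | And f g => holds pi i f /\ holds pi i g
  | Next f => i < (size pi).-1 /\ holds pi i.+1 f
  | Until f g =>
      exists j, [/\ i <= j < size pi, holds pi j g
                  & forall k, i <= k < j -> holds pi k f]
  end.

Definition models (P : finType) (pi : seq {set P}) (phi : ltlf P) : Prop :=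
  holds pi 0 phi.

(* The property written "forall phi". *)
Definition all_prefixes (X Y : finType) (phi : ltlf (X + Y)%type) : lang X Y :=
  fun w => forall n, models (mkseq w n.+1) phi.

Definition true_lang (X Y : finType) : lang X Y := fun=> True.

Definition ag_strategy (X Y : finType) := seq {set X} -> {set Y}.

(* Only the values on nonempty histories matter. *)
Definition env_strategy (X Y : finType) := seq {set Y} -> {set X}.

Definition follows_ag (X Y : finType) (s : ag_strategy X Y) (w : trace X Y) :=
  forall i, ag_part (w i) = s (mkseq (fun j => env_part (w j)) i).

Definition follows_env (X Y : finType) (e : env_strategy X Y) (w : trace X Y) :=
  forall i, env_part (w i) = e (mkseq (fun j => ag_part (w j)) i.+1).

Definition is_play (X Y : finType) (s : ag_strategy X Y) (e : env_strategy X Y)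
    (w : trace X Y) : Prop :=
  follows_ag s w /\ follows_env e w.

Definition env_enforces (X Y : finType) (e : env_strategy X Y) (Env : lang X Y) :=
  forall s w, is_play s e w -> Env w.

Definition enforces_under (X Y : finType) (s : ag_strategy X Y)
    (Task Env : lang X Y) : Prop :=
  forall e, env_enforces e Env -> forall w, is_play s e w -> Task w.

Record transducer (X Y : finType) := Transducer {
  tr_state : finType;
  tr_init : tr_state;
  tr_step : tr_state -> {set X} -> tr_state;
  tr_out : tr_state -> {set Y}
}.

Definition finite_state (X Y : finType) (s : ag_strategy X Y) : Prop :=
  exists t : transducer X Y,
    forall h, s h = tr_out (foldl (@tr_step X Y t) (tr_init t) h).

Record tsys (X Y : finType) := TSys {
  state :> finType;
  init : state;
  delta : state -> letter X Y -> state
}.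

Definition restart (X Y : finType) (D : tsys X Y) (q : D) : tsys X Y :=
  TSys q (@delta X Y D).

Fixpoint run (X Y : finType) (D : tsys X Y) (w : trace X Y) (n : nat) : D :=
  if n is m.+1 then delta (run D w m) (w m) else init D.

Definition run_end (X Y : finType) (D : tsys X Y) (u : seq (letter X Y)) : D :=
  foldl (@delta X Y D) (init D) u.

Record dfa (X Y : finType) := DFA {
  dfa_ts :> tsys X Y;
  final : {set dfa_ts}
}.

Definition accepts (X Y : finType) (M : dfa X Y) (u : seq (letter X Y)) : bool :=
  run_end M u \in final M.

Definition recognises (X Y : finType) (M : dfa X Y) (phi : ltlf (X + Y)%type) :=
  forall u, accepts M u <-> u <> [::] /\ models u phi.

(* Normal form needed for safe(F \cup {iota}) to capture "forall phi": were iota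
   re-entered, the prefix leading back to it would be rejected by the DFA and
   yet stay in the safe set.  It is no loss of generality (no_return_wlog). *)
Definition no_return (X Y : finType) (D : tsys X Y) : Prop :=
  forall u, u <> [::] -> run_end D u <> init D.

Definition fresh_init (X Y : finType) (M : dfa X Y) : dfa X Y :=
  let step (q : option M) a := Some (delta (odflt (init M) q) a) in
  DFA (dfa_ts := TSys None step) [set Some q | q in final M].

Lemma no_return_wlog (X Y : finType) (M : dfa X Y) (phi : ltlf (X + Y)%type) :
  recognises M phi ->
  recognises (fresh_init M) phi /\ no_return (fresh_init M).
Proof.
move=> hM.
have runE a u : run_end (fresh_init M) (a :: u) = Some (run_end M (a :: u)).
  by rewrite /run_end /=; elim: u (delta _ a) => //= b u IH q; apply: IH.
split=> [[|a u]|[//|a u] _]; last by rewrite runE.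
- by split=> [/imsetP[]|[]].
- rewrite /accepts runE (mem_imset _ _ (@Some_inj _)); exact: hM.
Qed.

Inductive objective (Q : finType) : Type :=
| Reach of {set Q}
| Safe of {set Q}.

Definition in_objective (Q : finType) (alpha : objective Q) (r : nat -> Q) : Prop :=
  match alpha with
  | Reach T => exists k, r k \in T
  | Safe T => forall k, r k \in T
  end.

Definition ag_wins (X Y : finType) (D : tsys X Y) (alpha : objective D)
    (s : ag_strategy X Y) (q : D) : Prop :=
  forall w, follows_ag s w -> in_objective alpha (run (restart q) w).

(* The agent's move in the current state q is f q, so the letters read along the
   fold are the agent's own previous moves joined with the X_i (strategyE). *)
Definition strategy (X Y : finType) (D : tsys X Y) (f : D -> {set Y}) :
    ag_strategy X Y :=
  fun h => f (foldl (fun q Xi => delta q (join (f q) Xi)) (init D) h).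

Lemma strategyE (X Y : finType) (D : tsys X Y) (f : D -> {set Y}) h :
  strategy f h =
  f (run_end D (mkseq (fun i => join (strategy f (take i h)) (nth set0 h i))
                      (size h))).
Proof.
rewrite /run_end {1}/strategy; congr f.
elim/last_ind: h => [//|h x IH].
rewrite size_rcons mkseqS !foldl_rcons /= nth_rcons ltnn eqxx.
have -> : take (size h) (rcons h x) = h by rewrite -cats1 take_size_cat.
rewrite -(_ : mkseq (fun i => join (strategy f (take i h)) (nth set0 h i)) (size h)
  = mkseq (fun i => join (strategy f (take i (rcons h x))) (nth set0 (rcons h x) i))
          (size h)); first by rewrite -IH.
apply/eq_in_map => i; rewrite mem_iota add0n => /andP[_ lti].
by rewrite nth_rcons lti -cats1 takel_cat // ltnW.
Qed.

Definition ag_solver (X Y : finType) :=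
  forall D : tsys X Y, objective D -> {set D} * (D -> {set Y}).

Definition solves_ag (X Y : finType) (solve : ag_solver X Y) : Prop :=
  forall (D : tsys X Y) (alpha : objective D),
    (forall q : D, q \in (solve D alpha).1 <-> exists s, ag_wins alpha s q) /\
    (forall q : D, q \in (solve D alpha).1 ->
       ag_wins alpha (strategy (D := restart q) (solve D alpha).2) q).

Record game (X Y : finType) := Game {
  arena : tsys X Y;
  goal : objective arena
}.

(* ConvertDA(forall phi), M being the DFA chosen for phi. *)
Definition convert_all (X Y : finType) (M : dfa X Y) : game X Y :=
  Game (Safe (final M :|: [set init M])).

(* None is the output "Unrealisable". *)
Definition algorithm2 (X Y : finType) (solve : ag_solver X Y) (M : dfa X Y) :
    option (ag_strategy X Y) :=
  let G := convert_all M in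
  let: (S1, f) := solve (arena G) (goal G) in
  if init (arena G) \in S1 then Some (strategy f) else None.

Definition solves_synthesis (X Y : finType) (Task Env : lang X Y)
    (out : option (ag_strategy X Y)) : Prop :=
  match out with
  | None => ~ exists s, enforces_under s Task Env
  | Some s => finite_state s /\ enforces_under s Task Env
  end.

(* Main.v *)
Require Import Defs.
From mathcomp Require Import all_boot.

Set Implicit Arguments.
Unset Strict Implicit.
Unset Printing Implicit Defensive.

(** Against an unconstrained environment, the plays of an agent strategy are
    exactly the traces that follow it: any such trace is produced by the
    environment strategy that replays its environment moves by time alone.
    Enforcing a property is therefore the same as winning, from the initial
    state, any game whose objective describes that property.  As the DFA never
    returns to its initial state, the safety game for F \cup {iota} describes
    "forall phi": a run stays in that set exactly when every nonempty prefix of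
    the trace is accepted. *)

Section Synthesis.
Variables X Y : finType.
Implicit Types (D : tsys X Y) (M : dfa X Y) (G : game X Y).
Implicit Types (w : trace X Y) (s : ag_strategy X Y) (L : lang X Y).

Lemma run_end_mkseq D w n : run_end D (mkseq w n) = run D w n.
Proof. by elim: n => //= n <-; rewrite mkseqS /run_end foldl_rcons. Qed.

Lemma run_restart_init D w : run (restart (init D)) w =1 run D w.
Proof. by elim=> //= n ->. Qed.

Lemma eq_in_objective (Q : finType) (alpha : objective Q) (r1 r2 : nat -> Q) :
  r1 =1 r2 -> in_objective alpha r1 <-> in_objective alpha r2.
Proof.
move=> eq_r; case: alpha => T /=; split.
- by case=> k; rewrite eq_r; exists k.
- by case=> k; rewrite -eq_r; exists k.
- by move=> rT k; rewrite -eq_r.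
- by move=> rT k; rewrite eq_r.
Qed.

Definition replay_env w : env_strategy X Y := fun h => env_part (w (size h).-1).

Lemma follows_replay_env w : follows_env (replay_env w) w.
Proof. by move=> i; rewrite /replay_env size_mkseq. Qed.

Lemma enforces_under_trueP s L :
  enforces_under s L (@true_lang X Y) <-> forall w, follows_ag s w -> L w.
Proof.
split=> [enf w sw | L_s e _ w [/L_s]] //.
by apply: (enf (replay_env w)) => //; split=> //; apply: follows_replay_env.
Qed.

Definition strategy_transducer D (f : D -> {set Y}) : transducer X Y :=
  Transducer (init D) (fun q Xi => delta q (join (f q) Xi)) f.

Lemma finite_state_strategy D (f : D -> {set Y}) : finite_state (strategy f).
Proof. by exists (strategy_transducer f). Qed.

Definition captures G L : Prop :=
  forall w, in_objective (goal G) (run (arena G) w) <-> L w.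

Lemma ag_wins_captures G L s : captures G L ->
  ag_wins (goal G) s (init (arena G)) <-> enforces_under s L (@true_lang X Y).
Proof.
move=> capL.
have objP w : in_objective (goal G) (run (restart (init (arena G))) w) <-> L w.
  by apply: iff_trans (capL w); apply/eq_in_objective/run_restart_init.
split=> [win | /enforces_under_trueP L_s w /L_s /objP //].
by apply/enforces_under_trueP=> w /win /objP.
Qed.

Definition synthesise (solve : ag_solver X Y) G : option (ag_strategy X Y) :=
  let: (S1, f) := solve (arena G) (goal G) in
  if init (arena G) \in S1 then Some (strategy f) else None.

Lemma synthesise_solves (solve : ag_solver X Y) G L :
  solves_ag solve -> captures G L ->
  solves_synthesis L (@true_lang X Y) (synthesise solve G).
Proof.
move=> solveP capL; have [regionP winning] := solveP _ (goal G).
rewrite /synthesise; case: (solve _ _) regionP winning => S1 f /= regionP winning.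
case: ifPn => [init_in | /negP init_out] /=.
- split; first exact: finite_state_strategy.
  by apply/(ag_wins_captures _ capL); apply: winning init_in.
- case=> s /(ag_wins_captures _ capL) win.
  by apply/init_out/regionP; exists s.
Qed.

Lemma no_return_run D w n : no_return D -> run D w n.+1 != init D.
Proof. by move=> noret; apply/eqP; rewrite -run_end_mkseq; apply: noret. Qed.

Lemma no_return_safe D (T : {set D}) w : no_return D ->
  in_objective (Safe (T :|: [set init D])) (run D w) <->
  forall n, run D w n.+1 \in T.
Proof.
move=> noret; split=> [safe n | runT [|n]].
- have := safe n.+1.
  by rewrite in_setU in_set1 (negPf (no_return_run _ _ noret)) orbF.
- by rewrite in_setU in_set1 eqxx orbT.
- by rewrite in_setU runT.
Qed.

Lemma recognises_run M (phi : ltlf (X + Y)%type) w n : recognises M phi ->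
  run M w n.+1 \in final M <-> models (mkseq w n.+1) phi.
Proof.
move=> recM; rewrite -run_end_mkseq.
by split=> [/recM [] // | mod_phi]; apply/recM.
Qed.

Lemma convert_all_captures M (phi : ltlf (X + Y)%type) :
  recognises M phi -> no_return M ->
  captures (convert_all M) (all_prefixes phi).
Proof.
move=> recM noret w; apply: iff_trans (no_return_safe _ _ noret) _.
by split=> phi_w n; apply/(recognises_run _ _ recM); apply: phi_w.
Qed.

End Synthesis.

Theorem theorem4 (X Y : finType) (solve_ag : ag_solver X Y)
    (hsolve : solves_ag solve_ag)
    (phi : ltlf (X + Y)%type) (M_phi : dfa X Y)
    (hM : recognises M_phi phi) (hinit : no_return M_phi) :
  solves_synthesis (all_prefixes phi) (@true_lang X Y)
    (algorithm2 solve_ag M_phi).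
Proof.
rewrite -[algorithm2 _ _]/(synthesise solve_ag (convert_all M_phi)).
exact: synthesise_solves hsolve (convert_all_captures hM hinit).
Qed.
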